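(* Let $A$, $\Omega=\bigcup_{i=1}^m\Omega_i$, $\mathcal{E}$, $W$, $M$, $\widehat{A}$ be as defined in the context, and assume that $A$ and $-W$ are symmetric positive definite. Let $\Lambda\subset\mathbb{R}^{\mathcal{E}}$ be a subspace with $\dim(\Lambda)=r$ and let $Z\in\mathbb{R}^{|\mathcal{E}|\times r}$ satisfy $\mathrm{range}(Z)=\Lambda$. Let $$\mathcal{M}=\widehat{A}+4M^TWZ\left(Z^TWZ\right)^{-1}Z^TWM,\qquad \Pi_\Lambda=Z(Z^TWZ)^{-1}Z^TW.$$ Let $\theta$ be an eigenvalue of $\mathcal{M}^{-1}A$. Then $$\frac{1}{1+K_\Lambda}\le\theta\le1,\qquad\text{where}\qquad K_\Lambda=\max_{p\in\mathbb{R}^\Omega,\ p\neq0}\frac{4\|(I-\Pi_\Lambda)Mp\|_{-W}^2}{\|p\|_A^2}.$$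
   Context: Let $A=(a_{kl})\in\mathbb{R}^{N\times N}$ be a symmetric matrix, with rows and columns indexed by $\Omega=\{1,\dots,N\}$. Let $\Omega=\bigcup_{i=1}^m\Omega_i$ be a partition into $m$ pairwise disjoint subsets (subdomains), with the indices ordered so that those of $\Omega_1,\Omega_2,\dots,\Omega_m$ are consecutive. $A_{ij}$ denotes the submatrix of $A$ with rows in $\Omega_i$ and columns in $\Omega_j$; for $i\ne j$ write $i\sim j$ if $A_{ij}\neq0$. For finite sets $X,Y$, $\mathbb{R}^X$ denotes real vectors indexed by $X$ and $\mathbb{R}^{X\times Y}$ real matrices with rows indexed by $X$ and columns by $Y$. Interface edges: $\mathcal{E}$ is the set of pairs $(k,l)$ with $k\in\Omega_i$, $l\in\Omega_j$ for some $i<j$ and $a_{kl}\ne0$. $W\in\mathbb{R}^{\mathcal{E}\times\mathcal{E}}$ is the diagonal matrix with entry $a_{kl}$ at $e=(k,l)\in\mathcal{E}$. The averaging matrix $M\in\mathbb{R}^{\mathcal{E}\times\Omega}$ is given by $(Mp)_e=\frac{p_k+p_l}{2}$ for $e=(k,l)\in\mathcal{E}$, $p\in\mathbb{R}^\Omega$. For $i\sim j$ let $D_{ij}=\mathrm{diag}(A_{ij}\mathbf{1}_{\Omega_j})$ (diagonal matrix indexed by $\Omega_i$ whose $k$-th diagonal entry is $\sum_{l\in\Omega_j}a_{kl}$), let $A_i=A_{ii}-\sum_{j:\,j\sim i}D_{ij}$, and let $\widehat{A}=\mathrm{diag}(A_1,\dots,A_m)\in\mathbb{R}^{\Omega\times\Omega}$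 (block diagonal). Norms: $\|p\|_A^2=p^TAp$ on $\mathbb{R}^\Omega$ and $\|\eta\|_{-W}^2=-\eta^TW\eta$ on $\mathbb{R}^{\mathcal{E}}$. The matrix $\mathcal{M}$ is symmetric positive definite under the stated assumptions, and all eigenvalues of $\mathcal{M}^{-1}A$ are real. *)

(* Defs.v *)
From mathcomp Require Import all_boot all_order all_algebra.
From mathcomp Require Import boolp classical_sets reals.

Set Implicit Arguments.
Unset Strict Implicit.
Unset Printing Implicit Defensive.
Import Order.TTheory GRing.Theory Num.Theory.
Local Open Scope ring_scope.

Section QuadraticForms.
Variable R : realType.

(* For a symmetric positive definite B this is the square of the norm ||p||_B. *)
Definition sqnorm n (B : 'M[R]_n) (p : 'cV[R]_n) : R := (p^T *m B *m p) 0 0.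

Definition spd n (B : 'M[R]_n) : Prop :=
  B^T = B /\ (forall p : 'cV[R]_n, p != 0 -> 0 < sqnorm B p).

Definition is_max (S : set R) (K : R) : Prop := S K /\ ubound S K.

End QuadraticForms.

(* A partition of the index set into m subdomains whose indices are
   consecutive: all indices of an earlier subdomain precede those of a later
   one. *)
Definition ordered_partition N m (Omega : 'I_m -> {set 'I_N}) : Prop :=
  [/\ forall i j, i != j -> [disjoint Omega i & Omega j],
      \bigcup_(i < m) Omega i = [set: 'I_N]
    & forall (i j : 'I_m) (k l : 'I_N),
        (i < j)%N -> k \in Omega i -> l \in Omega j -> (k < l)%N].

Section Subdomains.
Variables (R : realType) (N m : nat) (A : 'M[R]_N) (Omega : 'I_m -> {set 'I_N}).

(* Vectors in R^(Omega i) are indexed by 'I_#|Omega i| through enum_val, which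
   lists the elements of Omega i in increasing order. *)
Definition subm (i j : 'I_m) : 'M[R]_(#|Omega i|, #|Omega j|) :=
  mxsub enum_val enum_val A.

Definition neighbours (i j : 'I_m) : bool := (i != j) && (subm i j != 0).

Definition Dmx (i j : 'I_m) : 'M[R]_#|Omega i| :=
  diag_mx (subm i j *m (const_mx 1 : 'cV[R]_#|Omega j|))^T.

Definition Aloc (i : 'I_m) : 'M[R]_#|Omega i| :=
  subm i i - \sum_(j < m | neighbours j i) Dmx i j.

Definition restr (i : 'I_m) : 'M[R]_(#|Omega i|, N) := rowsub enum_val 1%:M.

(* Block diagonal matrix diag(B_1, ..., B_m), written as the sum of the
   extensions by zero of its blocks so as to be an N x N matrix without a cast
   from \sum_i #|Omega i| to N. *)
Definition blockdiag (B : forall i : 'I_m, 'M[R]_#|Omega i|) : 'M[R]_N :=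
  \sum_(i < m) (restr i)^T *m B i *m restr i.

Definition Ahat : 'M[R]_N := blockdiag Aloc.

Definition edges : {set 'I_N * 'I_N} :=
  [set e | [exists i : 'I_m, exists j : 'I_m,
     [&& (i < j)%N, e.1 \in Omega i, e.2 \in Omega j & A e.1 e.2 != 0]]].

(* Vectors in R^edges are indexed by 'I_#|edges| through enum_val. *)
Definition edge (e : 'I_#|edges|) : 'I_N * 'I_N := enum_val e.

Definition Wmx : 'M[R]_#|edges| :=
  diag_mx (\row_e A (edge e).1 (edge e).2).

Definition Mavg : 'M[R]_(#|edges|, N) :=
  \matrix_(e, k) ((((edge e).1 == k)%:R + ((edge e).2 == k)%:R) / 2).

Lemma MavgE (p : 'cV[R]_N) e :
  (Mavg *m p) e 0 = (p (edge e).1 0 + p (edge e).2 0) / 2.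
Proof.
have pick_entry (k : 'I_N) : \sum_j (k == j)%:R * p j 0 = p k 0.
  rewrite (bigD1 k) //= eqxx mul1r big1 ?addr0 // => j.
  by rewrite eq_sym => /negbTE ->; rewrite mul0r.
rewrite mxE; under eq_bigr do rewrite mxE mulrAC mulrDl.
by rewrite -mulr_suml big_split /= !pick_entry.
Qed.

Section Coarse.
Variables (r : nat) (Z : 'M[R]_(#|edges|, r)).

Definition Mcal : 'M[R]_N :=
  Ahat + 4 *: (Mavg^T *m Wmx *m Z *m invmx (Z^T *m Wmx *m Z)
               *m Z^T *m Wmx *m Mavg).

Definition Pi_Lambda : 'M[R]_#|edges| :=
  Z *m invmx (Z^T *m Wmx *m Z) *m Z^T *m Wmx.

Definition K_ratio (p : 'cV[R]_N) : R :=
  4 * sqnorm (- Wmx) ((1%:M - Pi_Lambda) *m (Mavg *m p)) / sqnorm A p.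

Definition is_K_Lambda (K : R) : Prop :=
  is_max [set K_ratio p | p in [set p : 'cV[R]_N | p != 0]]%classic K.

End Coarse.
End Subdomains.

(* Main.v *)
(* Writing Mp for the edge averages, (p_k + p_l)^2 summed against the a_kl over the
   interface edges gives p^T Ahat p = p^T A p + 4 ||Mp||_{-W}^2. As Pi_Lambda is the
   (-W)-orthogonal projection onto Lambda, this turns into
   p^T Mcal p = p^T A p + 4 ||(I - Pi_Lambda) M p||_{-W}^2.
   An eigenvalue theta with (left) eigenvector v satisfies p^T A p = theta p^T Mcal p
   for p = (v Mcal^-1)^T, so theta = 1 / (1 + ratio(p)) with 0 <= ratio(p) <= K_Lambda. *)
Require Import Defs.
From mathcomp Require Import all_boot all_order all_algebra.
From mathcomp Require Import ring.
From mathcomp Require Import boolp classical_sets reals topology normedtype derive.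
Set Implicit Arguments.
Unset Strict Implicit.
Unset Printing Implicit Defensive.
Import Order.TTheory GRing.Theory Num.Theory.
Local Open Scope ring_scope.

(** * Algebra of quadratic forms *)

Section QuadraticForms.
Variable R : realType.

Lemma sqnormE n (B : 'M[R]_n) (p : 'cV[R]_n) :
  sqnorm B p = \sum_k \sum_l B k l * p k 0 * p l 0.
Proof.
rewrite /sqnorm -mulmxA mxE; apply: eq_bigr => k _.
rewrite !mxE big_distrr; apply: eq_bigr => l _ /=; ring.
Qed.

Lemma sqnormD n (B C : 'M[R]_n) p : sqnorm (B + C) p = sqnorm B p + sqnorm C p.
Proof. by rewrite /sqnorm mulmxDr mulmxDl mxE. Qed.

Lemma sqnormZ n a (B : 'M[R]_n) p : sqnorm (a *: B) p = a * sqnorm B p.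
Proof. by rewrite /sqnorm -scalemxAr -scalemxAl mxE. Qed.

Lemma sqnormN n (B : 'M[R]_n) p : sqnorm (- B) p = - sqnorm B p.
Proof. by rewrite -scaleN1r sqnormZ mulN1r. Qed.

Lemma sqnorm0 n (p : 'cV[R]_n) : sqnorm 0 p = 0.
Proof. by rewrite /sqnorm mulmx0 mul0mx mxE. Qed.

Lemma sqnorm_sum n (I : finType) (P : pred I) (B : I -> 'M[R]_n) p :
  sqnorm (\sum_(i | P i) B i) p = \sum_(i | P i) sqnorm (B i) p.
Proof.
by apply: (big_morph (fun B => sqnorm B p)) => [B1 B2|];
  [exact: sqnormD | exact: sqnorm0].
Qed.

Lemma sqnorm_congr n m (B : 'M[R]_n) (C : 'M[R]_(n, m)) p :
  sqnorm (C^T *m B *m C) p = sqnorm B (C *m p).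
Proof. by rewrite /sqnorm trmx_mul !mulmxA. Qed.

Lemma sqnorm_scale n (B : 'M[R]_n) a p : sqnorm B (a *: p) = a ^+ 2 * sqnorm B p.
Proof.
by rewrite /sqnorm -scalemxAr linearZ /= -!scalemxAl !mxE mulrA expr2.
Qed.

Lemma sqnorm_diag n (d : 'rV[R]_n) p :
  sqnorm (diag_mx d) p = \sum_k d 0 k * p k 0 ^+ 2.
Proof.
rewrite sqnormE; apply: eq_bigr => k _.
rewrite (bigD1 k) //= big1 => [|l /negbTE lk].
  by rewrite mxE eqxx mulr1n addr0 expr2 mulrA.
by rewrite mxE eq_sym lk mulr0n !mul0r.
Qed.

Lemma posdef_sqnorm_ge0 n (B : 'M[R]_n) p :
  (forall q : 'cV[R]_n, q != 0 -> 0 < sqnorm B q) -> 0 <= sqnorm B p.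
Proof.
move=> B0; have [->|/B0/ltW //] := eqVneq p 0.
by rewrite /sqnorm mulmx0 mxE.
Qed.

(** A left kernel vector of [B], transposed, is a zero of the form. Asking only for [!= 0] covers
    both the negative definite [Z^T *m W *m Z] and the positive definite [Mcal Z]. *)
Lemma definite_unitmx n (B : 'M[R]_n) :
  (forall p : 'cV[R]_n, p != 0 -> sqnorm B p != 0) -> B \in unitmx.
Proof.
move=> B0; rewrite -row_free_unit; apply/inj_row_free => v vB.
apply/trmx_inj/eqP; rewrite trmx0; apply: contraT => /B0.
by rewrite /sqnorm trmxK vB mul0mx mxE eqxx.
Qed.

End QuadraticForms.

(** * Attainment of the maximum of a generalized Rayleigh quotient *)

Section RayleighMax.
Import numFieldNormedType.Exports.
Local Open Scope classical_set_scope.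
Variable R : realType.

Lemma continuous_bigsum (T : topologicalType) (I : Type) (s : seq I) (F : I -> T -> R) :
  (forall i, continuous (F i)) -> continuous (fun x => \sum_(i <- s) F i x).
Proof.
move=> cF; elim: s => [|i s IHs].
  by under eq_fun do rewrite big_nil; move=> x; exact: cvg_cst.
under eq_fun do rewrite big_cons.
by move=> x; apply: cvgD; [exact: cF|exact: IHs].
Qed.

Lemma sqnorm_tr_continuous n (B : 'M[R]_n) :
  continuous (fun v : 'rV[R]_n => sqnorm B v^T).
Proof.
under eq_fun do rewrite sqnormE; apply: continuous_bigsum => k.
apply: continuous_bigsum => l; under eq_fun do rewrite !mxE; move=> v.
apply: (continuousM (s := fun v : 'rV[R]_n => B k l * v 0 k)
                    (t := fun v : 'rV[R]_n => v 0 l)); last exact: coord_continuous.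
apply: (continuousM (s := fun=> B k l) (t := fun v : 'rV[R]_n => v 0 k)).
  exact: cst_continuous.
exact: coord_continuous.
Qed.

(* By homogeneity it suffices to maximise over the unit sphere, which is compact. *)
Lemma rayleigh_max n (B C : 'M[R]_n) (p0 : 'cV[R]_n) :
  (forall p : 'cV[R]_n, p != 0 -> 0 < sqnorm B p) -> p0 != 0 ->
  exists2 p : 'cV[R]_n, p != 0 &
    forall q : 'cV[R]_n, q != 0 ->
      sqnorm C q / sqnorm B q <= sqnorm C p / sqnorm B p.
Proof.
move=> B0 p0_neq0.
(* The norm here is the entrywise maximum norm; since the quotient is invariant under scaling, the
   sphere of any norm would do. *)
pose S := [set v : 'rV[R]_n | `|v| = 1].
have normalize (q : 'cV[R]_n) : q != 0 -> S (`|q^T|^-1 *: q^T).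
  move=> q0; rewrite /S /= normrZ normfV normr_id mulVf // normr_eq0.
  by rewrite trmx_eq0.
have S_neq0 v : S v -> v^T != 0.
  by move=> Sv; rewrite trmx_eq0 -normr_eq0 Sv oner_eq0.
have cS : compact S.
  apply: bounded_closed_compact.
    by exists 1; split=> // M M1 v /= ->; exact: ltW.
  apply: (@preimage_closed _ _ (fun v : 'rV[R]_n => `|v|) [set 1]); last exact: closed_eq.
  by move=> v _; exact: norm_continuous.
(* Continuity is claimed only within [S], where the denominator is nonzero. *)
have cf : {within S, continuous (fun v : 'rV[R]_n => sqnorm C v^T / sqnorm B v^T)}.
  rewrite continuous_subspace_in => v; rewrite inE => Sv.
  have sqnorm_cvg D := continuous_subspaceT (A := S) (@sqnorm_tr_continuous n D).
  apply: cvgM; first exact: sqnorm_cvg.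
  by apply: cvgV; [rewrite gt_eqF ?B0 ?S_neq0|exact: sqnorm_cvg].
have [|v] := compact_EVT_max _ cS cf; first by exists (`|p0^T|^-1 *: p0^T); exact: normalize.
rewrite inE => Sv vmax; exists v^T; first exact: S_neq0.
move=> q q0; have := normalize _ q0; rewrite -inE => /vmax.
rewrite linearZ /= trmxK !sqnorm_scale -mulf_div divff ?mul1r //.
by rewrite expf_neq0 // invr_eq0 normr_eq0 trmx_eq0.
Qed.
End RayleighMax.

(** * The quadratic form of [Ahat] as a sum over interface edges *)

Section Subdomains.
Variables (R : realType) (N m : nat) (A : 'M[R]_N) (Omega : 'I_m -> {set 'I_N}).

(** The block map [s] makes the subdomains its fibres, so that [partition_big] can regroup sums by
    subdomain. *)
Lemma ordered_partition_block : ordered_partition Omega ->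
  exists s : 'I_N -> 'I_m, forall k i, (k \in Omega i) = (s k == i).
Proof.
case=> disj cover _.
have /choice[s sP] (k : 'I_N) : exists i, k \in Omega i.
  have : k \in \bigcup_(i < m) Omega i by rewrite cover inE.
  by case/bigcupP => i _ ki; exists i.
exists s => k i; apply/idP/eqP => [ki|<- //].
apply/eqP; apply: contraT => /disj /disjointFr /(_ (sP k)).
by rewrite ki.
Qed.

Lemma restrE i (p : 'cV[R]_N) a :
  (restr R Omega i *m p) a 0 = p (enum_val a) 0.
Proof. by rewrite /restr mul_rowsub_mx mul1mx mxE. Qed.

Lemma sqnorm_subm i p :
  sqnorm (subm A Omega i i) (restr R Omega i *m p)
  = \sum_(k in Omega i) \sum_(l in Omega i) A k l * p k 0 * p l 0.
Proof.
rewrite sqnormE [RHS]big_enum_val; apply: eq_bigr => a _.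
rewrite [RHS]big_enum_val; apply: eq_bigr => b _.
by rewrite !restrE mxE.
Qed.

Lemma sqnorm_Dmx i j p :
  sqnorm (Dmx A Omega i j) (restr R Omega i *m p)
  = \sum_(k in Omega i) \sum_(l in Omega j) A k l * p k 0 ^+ 2.
Proof.
rewrite sqnorm_diag [RHS]big_enum_val; apply: eq_bigr => a _.
rewrite restrE !mxE mulr_suml [RHS]big_enum_val; apply: eq_bigr => b _.
by rewrite !mxE mulr1.
Qed.

Hypotheses (partO : ordered_partition Omega) (symA : A^T = A).

(** [Aloc] selects [j] by the block [(j, i)] while [Dmx i j] is built from [(i, j)]; symmetry of [A]
    links them. Hence the sum over neighbours may be extended to all [j != i]. *)
Lemma Dmx_eq0 i j : subm A Omega j i = 0 -> Dmx A Omega i j = 0.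
Proof.
move=> Aji; rewrite /Dmx (_ : subm A Omega i j = 0).
  by rewrite mul0mx trmx0 raddf0.
apply/matrixP => a b; have := congr1 (fun B : 'M__ => B b a) Aji.
by rewrite !mxE -{1}symA mxE.
Qed.

Lemma sqnorm_Aloc i p :
  sqnorm (Aloc A Omega i) (restr R Omega i *m p)
  = \sum_(k in Omega i) (\sum_(l in Omega i) A k l * p k 0 * p l 0
      - \sum_(j | j != i) \sum_(l in Omega j) A k l * p k 0 ^+ 2).
Proof.
rewrite sqnormD sqnormN sqnorm_subm sqnorm_sum sumrB; congr (_ - _).
rewrite exchange_big big_mkcond [RHS]big_mkcond; apply: eq_bigr => j _ /=.
rewrite -sqnorm_Dmx /neighbours; case: (j != i) => //=.
by case: eqP => //= /Dmx_eq0 ->; rewrite sqnorm0.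
Qed.

Lemma sqnorm_Ahat p :
  sqnorm (Ahat A Omega) p
  = sqnorm A p + 4 * sqnorm (- Wmx A Omega) (Mavg A Omega *m p).
Proof.
have [s sP] := ordered_partition_block partO.
(* For [k], [l] in different blocks, [A] contributes [a_kl p_k p_l] and [Ahat] contributes
   [- a_kl p_k^2]; [F k l] is the difference. *)
pose F k l := A k l * p k 0 * (p k 0 + p l 0).
have -> : sqnorm (Ahat A Omega) p
    = sqnorm A p - \sum_k \sum_(l | s l != s k) F k l.
  rewrite /Ahat /blockdiag sqnorm_sum.
  under eq_bigr do rewrite sqnorm_congr sqnorm_Aloc.
  rewrite sqnormE -sumrB [RHS](partition_big s predT) //=.
  apply: eq_bigr => i _; under eq_bigl do rewrite sP.
  apply: eq_bigr => k /eqP <-; under eq_bigl do rewrite sP.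
  have -> : \sum_(j | j != s k) \sum_(l in Omega j) A k l * p k 0 ^+ 2
      = \sum_(l | s l != s k) A k l * p k 0 ^+ 2.
    rewrite [RHS](partition_big s (fun j => j != s k)) //=.
    apply: eq_bigr => j jk; apply: eq_bigl => l; rewrite sP.
    by have [->|] := eqVneq (s l) j; rewrite ?andbF ?jk.
  rewrite [X in _ = X - _](bigID (fun l => s l == s k)) /= -addrA; congr (_ + _).
  rewrite -sumrB -sumrN; apply: eq_bigr => l _; rewrite /F; ring.
rewrite sqnormN mulrN; congr (_ - _).
rewrite sqnorm_diag mulr_sumr.
(* By symmetry of [A], [F k l + F l k = a_kl (p_k + p_l)^2], which is four times the term of the
   edge [(k, l)] in the form of [W] at [Mp]. *)
transitivity (\sum_(x in edges A Omega) (F x.1 x.2 + F x.2 x.1)); last first.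
  rewrite big_enum_val; apply: eq_bigr => e _.
  rewrite MavgE !mxE /F.
  have -> : A (enum_val e).2 (enum_val e).1 = A (enum_val e).1 (enum_val e).2.
    by rewrite -{1}symA mxE.
  by rewrite /edge; field.
(* Pairs with [a_kl = 0] add nothing, so edges may be replaced by all pairs with [s k < s l]. *)
have -> : \sum_(x in edges A Omega) (F x.1 x.2 + F x.2 x.1)
    = \sum_k \sum_(l | (s k < s l)%N) (F k l + F l k).
  rewrite pair_big_dep /= big_mkcond [RHS]big_mkcond /=.
  apply: eq_bigr => -[k l] _ /=; rewrite inE /=.
  have -> : [exists i : 'I_m, exists j : 'I_m, [&& (i < j)%N, k \in Omega i, l \in Omega j & A k l != 0]]
      = (s k < s l)%N && (A k l != 0).
    apply/existsP/idP => [[i /existsP[j]]|/andP[skl Akl]].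
      by rewrite !sP => /and4P[ij /eqP-> /eqP-> ->]; rewrite ij.
    by exists (s k); apply/existsP; exists (s l); rewrite !sP !eqxx skl.
  have [Akl|_] := eqVneq (A k l) 0; last by rewrite andbT.
  have Alk : A l k = 0 by rewrite -symA mxE.
  by rewrite andbF /F Akl Alk !mul0r addr0 if_same.
(* Exchanging the sums in the [F l k] half turns it into the pairs with [s l < s k]; the two halves
   together give [s l != s k]. *)
under [RHS]eq_bigr do rewrite big_split.
rewrite big_split /= [X in _ = _ + X](exchange_big_dep predT) //= -big_split /=.
apply: eq_bigr => k _; rewrite (bigID (fun l => (s k < s l)%N)) /=.
congr (_ + _); apply: eq_bigl => l; rewrite -val_eqE /= neq_ltn ?[(s l == s k)]eq_sym;
  by case: ltngtP.
Qed.

(** * The coarse projection and the form of [Mcal] *)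

Section Coarse.
Variables (r : nat) (Z : 'M[R]_(#|edges A Omega|, r)).
Local Notation W := (Wmx A Omega).
Local Notation M := (Mavg A Omega).
Hypothesis Zinj : forall q : 'cV[R]_r, Z *m q = 0 -> q = 0.
Hypothesis posW : forall p, p != 0 -> 0 < sqnorm (- W) p.

(** As [Z] is injective, the negative definiteness of [W] passes to [Z^T *m W *m Z]. *)
Lemma coarse_unitmx : Z^T *m W *m Z \in unitmx.
Proof.
apply: definite_unitmx => q q0; rewrite sqnorm_congr -oppr_eq0 -sqnormN.
rewrite gt_eqF // posW //; apply: contraNneq q0 => /Zinj ->; exact: eqxx.
Qed.

(* Pi_Lambda is the (-W)-orthogonal projection onto range Z. *)
Lemma sqnorm_sub_Pi eta :
  sqnorm (- W) ((1%:M - Pi_Lambda Z) *m eta)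
  = sqnorm (W *m Pi_Lambda Z) eta - sqnorm W eta.
Proof.
have WT : W^T = W by rewrite tr_diag_mx.
have PiT : (Pi_Lambda Z)^T *m W = W *m Pi_Lambda Z.
  by rewrite /Pi_Lambda !trmx_mul trmx_inv !trmx_mul !trmxK WT !mulmxA.
have PiPi : Pi_Lambda Z *m Pi_Lambda Z = Pi_Lambda Z.
  move: coarse_unitmx; rewrite /Pi_Lambda; set G := _ *m _ *m Z => Gunit.
  rewrite !mulmxA -(mulmxA _ Z^T W) -(mulmxA (Z *m invmx G) Z^T W).
  by rewrite -(mulmxA (Z *m invmx G) _ Z) -/G mulmxK // !mulmxA.
(* It remains to see that [(I - Pi)^T (-W) (I - Pi) = W Pi - W], from self-adjointness [PiT] and
   idempotence [PiPi]. *)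
rewrite -sqnorm_congr -sqnormN -sqnormD; congr sqnorm.
rewrite [_^T]linearB /= trmx1 mulmxN mulNmx mulmxBl mul1mx PiT mulmxBr mulmx1.
by rewrite mulmxBl -mulmxA PiPi subrr subr0 opprB.
Qed.

(** The coarse term is [4 M^T (W Pi) M], and the [-4 W] term at [Mp] coming from [Ahat] is the one
    in the projection identity. *)
Lemma sqnorm_Mcal p :
  sqnorm (Mcal Z) p
  = sqnorm A p + 4 * sqnorm (- W) ((1%:M - Pi_Lambda Z) *m (M *m p)).
Proof.
rewrite sqnorm_sub_Pi sqnormD sqnorm_Ahat sqnormZ sqnormN.
rewrite (_ : _ *m M = M^T *m (W *m Pi_Lambda Z) *m M) ?sqnorm_congr; first ring.
by rewrite /Pi_Lambda !mulmxA.
Qed.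
End Coarse.
End Subdomains.

(** Rank-nullity: the image already has dimension [r], the number of columns, so the kernel is
    zero. *)
Lemma full_rank_mulmx_inj (F : fieldType) n r (Lambda : {vspace 'cV[F]_n})
    (Z : 'M[F]_(n, r)) (q : 'cV[F]_r) :
  \dim Lambda = r ->
  limg (linfun (mulmx Z : 'cV[F]_r -> 'cV[F]_n)) = Lambda ->
  Z *m q = 0 -> q = 0.
Proof.
move=> dimL rangeZ Zq.
have := limg_ker_dim (linfun (mulmx Z : 'cV[F]_r -> 'cV[F]_n)) fullv.
rewrite rangeZ dimL dimvf dim_matrix mulr1 capfv -[RHS]add0n => /addIn/eqP.
rewrite dimv_eq0 => /lker0P inj; apply: inj.
by rewrite !lfunE /= Zq mulmx0.
Qed.

(** * Eigenvalue bounds for the preconditioned matrix *)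

Theorem proposition5p3 (R : realType) (N m : nat) (A : 'M[R]_N)
    (Omega : 'I_m -> {set 'I_N}) (r : nat)
    (Lambda : {vspace 'cV[R]_#|edges A Omega|})
    (Z : 'M[R]_(#|edges A Omega|, r)) (theta : R) :
  ordered_partition Omega ->
  spd A ->
  spd (- Wmx A Omega) ->
  \dim Lambda = r ->
  limg (linfun (mulmx Z : 'cV[R]_r -> 'cV[R]_#|edges A Omega|)) = Lambda ->
  eigenvalue (invmx (Mcal Z) *m A) theta ->
  exists K : R, is_K_Lambda Z K /\ 1 / (1 + K) <= theta <= 1.
Proof.
move=> partO [symA posA] [_ posW] dimL rangeZ /eigenvalueP[v vE v0].
have Zinj q := full_rank_mulmx_inj (q := q) dimL rangeZ.
pose X := (1%:M - Pi_Lambda Z) *m Mavg A Omega.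
(* With this [C], [K_ratio] is the Rayleigh quotient of [C] over [A], as [rayleigh_max] requires. *)
pose C := 4 *: (X^T *m (- Wmx A Omega) *m X).
have CE p : sqnorm C p
    = 4 * sqnorm (- Wmx A Omega) ((1%:M - Pi_Lambda Z) *m (Mavg A Omega *m p)).
  by rewrite sqnormZ sqnorm_congr mulmxA.
have ratioE p : K_ratio Z p = sqnorm C p / sqnorm A p by rewrite CE.
have C_ge0 p : 0 <= sqnorm C p by rewrite CE mulr_ge0 ?posdef_sqnorm_ge0.
have McalE p : sqnorm (Mcal Z) p = sqnorm A p + sqnorm C p.
  by rewrite CE sqnorm_Mcal.
have McalU : Mcal Z \in unitmx.
  apply: definite_unitmx => p p0; rewrite McalE gt_eqF //.
  by rewrite ltr_wpDr ?posA.
pose p := (v *m invmx (Mcal Z))^T.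
have p0 : p != 0.
  rewrite trmx_eq0; apply: contraNneq v0 => vM.
  by rewrite -(mulmxKV McalU v) vM mul0mx.
have pE : sqnorm A p = theta * (sqnorm A p + sqnorm C p).
  rewrite -McalE /sqnorm trmxK -mulmxA in vE *.
  by rewrite mulmxA -(mulmxA v) vE mulmxKV // -scalemxAl mxE.
(* The vector [p] also witnesses that nonzero vectors exist, without which there would be no
   maximum. *)
have [pm pm0 pmax] := rayleigh_max C posA p0.
exists (K_ratio Z pm); split.
  split; first by exists pm.
  by move=> _ [q q0 <-]; rewrite !ratioE pmax.
have := pmax _ p0; rewrite -(ratioE pm); set K := K_ratio Z pm => leK.
have a0 := posA _ p0; have c0 := C_ge0 p.
have s0 : 0 < sqnorm A p + sqnorm C p by rewrite ltr_wpDr.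
have -> : theta = sqnorm A p / (sqnorm A p + sqnorm C p).
  by rewrite {1}pE mulfK ?gt_eqF.
have K0 : 0 <= K by rewrite (le_trans _ leK) // divr_ge0 // ltW.
apply/andP; split; last by rewrite ler_pdivrMr // mul1r lerDl.
(* With [a], [c] the values of the forms [A], [C] at [p], the lower bound reads
   [a + c <= a (1 + K)], that is [c / a <= K]. *)
rewrite ler_pdivlMr // mulrAC mul1r ler_pdivrMr ?ltr_wpDr //.
by rewrite mulrDr mulr1 lerD2l mulrC -ler_pdivrMr.
Qed.
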